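(* Let $\mathcal T=[\mathbf A,\mathbf B,\mathbf C]_R$ with $\mathbf A\in\mathbb F^{I\times R}$, $\mathbf B\in\mathbb F^{J\times R}$, $\mathbf C\in\mathbb F^{K\times R}$, and let $m_{\mathbf C}:=R-r_{\mathbf C}+2$. Assume that (i) $\max\bigl(\min(k_{\mathbf A},k_{\mathbf B}-1),\ \min(k_{\mathbf A}-1,k_{\mathbf B})\bigr)+k_{\mathbf C}\ge R+1$; (ii) $H_{\mathbf A\mathbf B}(\delta)\ge\min(\delta,m_{\mathbf C})$ for all $\delta=1,2,\dots,R$. Then $r_{\mathcal T}=R$ and the CPD of $\mathcal T$ is unique.
   Context: $\mathbb F$ is $\mathbb R$ or $\mathbb C$. For matrices $\mathbf A,\mathbf B,\mathbf C$ with $R$ nonzero columns each, $[\mathbf A,\mathbf B,\mathbf C]_R:=\sum_{r=1}^R\mathbf a_r\circ\mathbf b_r\circ\mathbf c_r$ ($\circ$ = outer product). The rank $r_{\mathcal T}$ of a tensor is the minimal number of terms in such a representation; a representation with $R=r_{\mathcal T}$ terms is a canonical polyadic decomposition (CPD). The CPD of a tensor $\mathcal T$ of rank $R$ is unique if $\mathcal T=[\mathbf A,\mathbf B,\mathbf C]_R=[\bar{\mathbf A},\bar{\mathbf B},\bar{\mathbf C}]_R$ implies that there are an $R\times R$ permutation matrix $\mathbf\Pi$ and nonsingular diagonal matrices $\mathbf\Lambda_{\mathbf A},\mathbf\Lambda_{\mathbf B},\mathbf\Lambda_{\mathbf C}$ with $\bar{\mathbf A}=\mathbf A\mathbf\Pi\mathbf\Lambda_{\mathbf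 A}$, $\bar{\mathbf B}=\mathbf B\mathbf\Pi\mathbf\Lambda_{\mathbf B}$, $\bar{\mathbf C}=\mathbf C\mathbf\Pi\mathbf\Lambda_{\mathbf C}$, $\mathbf\Lambda_{\mathbf A}\mathbf\Lambda_{\mathbf B}\mathbf\Lambda_{\mathbf C}=\mathbf I_R$. $r_{\mathbf M}$ is the rank of a matrix $\mathbf M$; its $k$-rank $k_{\mathbf M}$ is the largest $k$ such that every set of $k$ columns of $\mathbf M$ is linearly independent. For matrices $\mathbf X,\mathbf Y$ with $R$ columns and $1\le\delta\le R$, $H_{\mathbf X\mathbf Y}(\delta):=\min_{S}\,[\,r_{\mathbf X_S}+r_{\mathbf Y_S}-\delta\,]$, where $S$ ranges over subsets of $\{1,\dots,R\}$ of cardinality $\delta$ and $\mathbf X_S,\mathbf Y_S$ are the submatrices formed by the columns indexed by $S$. *)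

(* Defs.v *)
From HB Require Import structures.
From mathcomp Require Import all_boot all_order all_algebra all_fingroup.
From mathcomp Require Import boolp reals complex.

Set Implicit Arguments.
Unset Strict Implicit.
Unset Printing Implicit Defensive.

Import Order.TTheory GRing.Theory Num.Theory.
Local Open Scope ring_scope.

Inductive real_or_complex (RR : realType) : fieldType -> Prop :=
| Is_real : real_or_complex RR (RR : fieldType)
| Is_complex : real_or_complex RR (RR[i] : fieldType).

Section Tensors.
Variables (F : fieldType) (I J K : nat).

Definition tensor := {ffun 'I_I * 'I_J * 'I_K -> F}.

Definition outer (a : 'cV[F]_I) (b : 'cV[F]_J) (c : 'cV[F]_K) : tensor :=
  [ffun x => a x.1.1 0 * b x.1.2 0 * c x.2 0].

Definition nonzero_cols (m n : nat) (M : 'M[F]_(m, n)) : Prop :=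
  forall r : 'I_n, col r M != 0.

(* T = [A, B, C]_R; the bracket is only defined for matrices whose columns
   are all nonzero, so this is part of the relation. *)
Definition is_PD (T : tensor) (R : nat)
    (A : 'M[F]_(I, R)) (B : 'M[F]_(J, R)) (C : 'M[F]_(K, R)) : Prop :=
  [/\ nonzero_cols A, nonzero_cols B, nonzero_cols C
    & T = \sum_(r < R) outer (col r A) (col r B) (col r C)].

Definition has_PD (T : tensor) (R : nat) : Prop :=
  exists (A : 'M[F]_(I, R)) (B : 'M[F]_(J, R)) (C : 'M[F]_(K, R)),
    is_PD T A B C.

Lemma has_PD_support (T : tensor) : has_PD T #|[set x | T x != 0]|.
Proof.
set S := [set x | T x != 0].
pose p (r : 'I_#|S|) := enum_val r.
exists (\matrix_(i, r) (T (p r) *+ (i == (p r).1.1))).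
exists (\matrix_(j, r) ((j == (p r).1.2)%:R)).
exists (\matrix_(k, r) ((k == (p r).2)%:R)).
have nz r : T (p r) != 0 by have := enum_valP r; rewrite inE.
split.
- move=> r; apply/eqP => /colP /(_ (p r).1.1) /eqP.
  by rewrite !mxE eqxx mulr1n (negPf (nz r)).
- move=> r; apply/eqP => /colP /(_ (p r).1.2) /eqP.
  by rewrite !mxE eqxx oner_eq0.
- move=> r; apply/eqP => /colP /(_ (p r).2) /eqP.
  by rewrite !mxE eqxx oner_eq0.
apply/ffunP => x; rewrite sum_ffunE.
have E r : outer (col r (\matrix_(i, r) (T (p r) *+ (i == (p r).1.1))))
    (col r (\matrix_(j, r) ((j == (p r).1.2)%:R)))
    (col r (\matrix_(k, r) ((k == (p r).2)%:R))) x = T x *+ (x == p r).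
  rewrite ffunE !mxE; case: x => [[i j] k]; case: (p r) => [[i' j'] k'] /=.
  rewrite !xpair_eqE.
  case: (eqVneq i i') => [->|_]; last by rewrite !mul0r.
  case: (eqVneq j j') => [->|_]; last by rewrite mulr0 mul0r.
  by case: (eqVneq k k') => [->|_]; rewrite /= ?mulr1 ?mulr0.
rewrite (eq_bigr _ (fun r _ => E r)).
have [Tx0|Tx0] := eqVneq (T x) 0.
  by rewrite Tx0 big1 // => r _; rewrite mul0rn.
have xS : x \in S by rewrite inE.
rewrite (bigD1 (enum_rank_in xS x)) //= big1 ?addr0.
  by rewrite /p enum_rankK_in // eqxx.
move=> r rx; case: eqP => // xr; case/eqP: rx.
by apply: enum_val_inj; rewrite enum_rankK_in.
Qed.

Lemma ex_has_PD (T : tensor) : exists R : nat, `[< has_PD T R >].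
Proof. by exists #|[set x | T x != 0]|; apply/asboolP/has_PD_support. Qed.

Definition tensor_rank (T : tensor) : nat := ex_minn (ex_has_PD T).

Definition is_CPD (T : tensor) (R : nat)
    (A : 'M[F]_(I, R)) (B : 'M[F]_(J, R)) (C : 'M[F]_(K, R)) : Prop :=
  R = tensor_rank T /\ is_PD T A B C.

Definition CPD_unique (T : tensor) : Prop :=
  forall (R : nat) (A A' : 'M[F]_(I, R)) (B B' : 'M[F]_(J, R))
    (C C' : 'M[F]_(K, R)),
  is_CPD T A B C -> is_CPD T A' B' C' ->
  exists Pi LA LB LC : 'M[F]_R,
    [/\ is_perm_mx Pi,
        [/\ is_diag_mx LA, is_diag_mx LB & is_diag_mx LC],
        [/\ LA \in unitmx, LB \in unitmx & LC \in unitmx],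
        [/\ A' = A *m Pi *m LA, B' = B *m Pi *m LB & C' = C *m Pi *m LC]
      & LA *m LB *m LC = 1%:M].

End Tensors.

Section KRank.
Variable F : fieldType.

Definition cols_of (m n : nat) (M : 'M[F]_(m, n)) (S : {set 'I_n}) :
    'M[F]_(m, #|S|) :=
  colsub (fun j : 'I_#|S| => enum_val j) M.

(* row_free of the transpose: the columns are linearly independent. *)
Definition k_rank (m n : nat) (M : 'M[F]_(m, n)) : nat :=
  \max_(k < n.+1 | [forall S : {set 'I_n},
                     (#|S| == k) ==> row_free (cols_of M S)^T]) k.

(* Integer valued, as the bracket may be negative.  The seed delta of the
   minimum is harmless: each bracket is at most delta, both ranks being at most
   delta, and some S has cardinality delta when delta <= R. *)
Definition Hfun (m n R : nat) (X : 'M[F]_(m, R)) (Y : 'M[F]_(n, R))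
    (delta : nat) : int :=
  \big[Num.min/delta%:Z]_(S : {set 'I_R} | #|S| == delta)
    ((\rank (cols_of X S))%:Z + (\rank (cols_of Y S))%:Z - delta%:Z).

Definition m_index (m R : nat) (C : 'M[F]_(m, R)) : int :=
  R%:Z - (\rank C)%:Z + 2.

End KRank.

(* Main.v *)
Require Import Defs.
From mathcomp Require Import all_boot all_order all_algebra all_fingroup.
From mathcomp Require Import boolp reals complex zify.

(* The rank of [A diag(C^T x) B^T] is at most the weight of [C'^T x] for any other
decomposition [A', B', C']; by Sylvester's inequality and (ii) it is at least the weight
of [C^T x] unless [C'^T x] has weight [>= m_C].  Kruskal's permutation lemma then
matches the columns of [C'] with those of [C], and shows that [C'] has at least [R]
columns.  Once [C' = C], choose [x] with [C^T x] supported exactly on a set [U] of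
[R + 1 - k_C] indices: by (i) the columns of [B] and [B'] indexed by [U] span the same
space (after exchanging [A] and [B] if necessary, [k_B > |U|]).  Letting [U] vary over the sets
containing [r] forces [b'_r] to be proportional to [b_r], and cancelling [B^T] gives
the same for [A]. *)

Set Implicit Arguments.
Unset Strict Implicit.
Unset Printing Implicit Defensive.

Import Order.TTheory GRing.Theory Num.Theory.
Local Open Scope ring_scope.

(** * Supports of vectors, k-ranks and ranks of slices *)

Lemma card_superset (T : finType) (S : {set T}) (k : nat) :
  (#|S| <= k <= #|T|)%N -> exists2 U : {set T}, S \subset U & #|U| = k.
Proof.
case/andP=> leSk lekT; elim: k leSk lekT => [|k IHk] leSk lekT.
  by exists S => //; apply/eqP; rewrite eqn_leq leSk.
move: leSk; rewrite leq_eqVlt => /orP[/eqP eqSk|ltSk]; first by exists S.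
have [U sSU cardU] := IHk ltSk (ltnW lekT).
have /set0Pn[t] : ~: U != set0.
  by rewrite -card_gt0; have := cardsC U; lia.
rewrite inE => tU; exists (t |: U).
  by apply: subset_trans sSU _; apply: subsetUr.
by rewrite cardsU1 tU cardU.
Qed.

Definition supp (F : fieldType) (n : nat) (v : 'cV[F]_n) : {set 'I_n} :=
  [set r | v r 0 != 0].

Section Weights.
Variable F : fieldType.

Lemma suppP (n : nat) (v : 'cV[F]_n) (r : 'I_n) : reflect (v r 0 = 0) (r \notin supp v).
Proof. by rewrite inE negbK; apply: eqP. Qed.

Lemma supp_mul_cols (m n : nat) (M : 'M[F]_(m, n)) (v : 'cV[F]_n)
    (S : {set 'I_n}) : supp v \subset S ->
  M *m v = cols_of M S *m \col_j v (enum_val j) 0.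
Proof.
move=> sS; apply/colP=> i; rewrite !mxE (bigID [in S]) /= [X in _ + X]big1.
  rewrite addr0 big_enum_val; apply: eq_bigr => j _; by rewrite !mxE.
move=> r rS; have /suppP-> : r \notin supp v by apply: contra rS; apply/subsetP.
by rewrite mulr0.
Qed.

Lemma k_rank_le (m n : nat) (M : 'M[F]_(m, n)) : (k_rank M <= n)%N.
Proof. by apply/bigmax_leqP => i _; rewrite -ltnS. Qed.

Lemma k_rank_free (m n : nat) (M : 'M[F]_(m, n)) (S : {set 'I_n}) :
  #|S| = k_rank M -> row_free (cols_of M S)^T.
Proof.
rewrite /k_rank; set P := fun k : 'I_n.+1 =>
  [forall S : {set 'I_n}, (#|S| == k) ==> row_free (cols_of M S)^T].
have [|k Pk ->] := @eq_bigmax_cond _ [pred k | P k] (fun k => val k).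
  (* The empty family is independent, so [k = 0] qualifies and the maximum is attained. *)
  apply/card_gt0P; exists ord0; rewrite inE; apply/forallP => U.
  apply/implyP=> /eqP cU; rewrite /row_free eqn_leq rank_leq_row /=.
  by rewrite {1}cU.
by move: Pk; rewrite inE => /forallP/(_ S)/implyP PS /eqP/PS.
Qed.

(** The support extends to a set of exactly [k_rank M] columns, and these are independent. The
    k-rank mostly enters later arguments in this form. *)
Lemma k_rank_kernel (m n : nat) (M : 'M[F]_(m, n)) (v : 'cV[F]_n) :
  M *m v = 0 -> (#|supp v| <= k_rank M)%N -> v = 0.
Proof.
move=> Mv0 wtv; have [|S sS cardS] := @card_superset _ (supp v) (k_rank M).
  by rewrite wtv card_ord k_rank_le.
have free := k_rank_free cardS.
have := supp_mul_cols M sS; rewrite Mv0 => /esym/(congr1 trmx)/eqP.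
rewrite trmx_mul trmx0 mulmx_free_eq0 // => /eqP/rowP w0.
apply/colP=> r; rewrite mxE; apply/suppP; apply/negP => rv.
have rS := subsetP sS _ rv.
have := w0 (enum_rank_in rS r); rewrite !mxE enum_rankK_in // => /suppP.
by rewrite rv.
Qed.


(** Restricting to the support makes the diagonal factor invertible, so only the ranks of the two
    column submatrices matter. *)
Lemma diag_supp (m n p : nat) (A : 'M[F]_(m, n)) (v : 'cV[F]_n)
    (B : 'M[F]_(p, n)) :
  A *m diag_mx v^T *m B^T =
  cols_of A (supp v) *m diag_mx (\row_j v (enum_val j) 0)
    *m (cols_of B (supp v))^T.
Proof.
apply/matrixP=> i j; rewrite !mul_mx_diag !mxE (bigID [in supp v]) /=.
rewrite [X in _ + X]big1 ?addr0 => [|r /suppP r0]; last first.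
  by rewrite !mxE r0 mulr0 mul0r.
by rewrite big_enum_val; apply: eq_bigr => r _; rewrite !mxE.
Qed.

Lemma row_free_diag (n : nat) (S : {set 'I_n}) (v : 'cV[F]_n) :
  S \subset supp v ->
  row_free (diag_mx (\row_(j < #|S|) v (enum_val j) 0)).
Proof.
move=> sS; rewrite row_free_unit unitmxE det_diag unitfE.
apply/prodf_neq0 => j _; rewrite mxE.
by have := subsetP sS _ (enum_valP j); rewrite inE.
Qed.

Lemma rank_diag_le (m n p : nat) (A : 'M[F]_(m, n)) (v : 'cV[F]_n)
    (B : 'M[F]_(p, n)) :
  (\rank (A *m diag_mx v^T *m B^T) <= #|supp v|)%N.
Proof.
rewrite diag_supp -mulmxA; apply: leq_trans (mxrankM_maxl _ _) _.
exact: rank_leq_col.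
Qed.

(* This is Sylvester's inequality for the columns in the support of [v]. *)
Lemma Hfun_le_rank (m n p : nat) (A : 'M[F]_(m, n)) (v : 'cV[F]_n)
    (B : 'M[F]_(p, n)) :
  Hfun A B #|supp v| <= (\rank (A *m diag_mx v^T *m B^T))%:Z.
Proof.
apply: le_trans (bigmin_le_cond _ _ (eqxx #|supp v|)) _.
have := mxrank_mul_min (cols_of A (supp v) *m diag_mx (\row_j v (enum_val j) 0))
  (cols_of B (supp v))^T.
rewrite -diag_supp mxrankMfree ?row_free_diag // mxrank_tr leq_subLR.
rewrite lerBlDl -!PoszD lez_nat; exact.
Qed.

(** Every vector in the row space of [X *m diag_mx v^T] is supported in [supp v], and by
    [k_rank_kernel] the map [M^T] kills no such vector except zero. *)
Lemma rank_mul_diag_tr (m n p : nat) (X : 'M[F]_(m, n)) (v : 'cV[F]_n)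
    (M : 'M[F]_(p, n)) : (#|supp v| <= k_rank M)%N ->
  \rank (X *m diag_mx v^T *m M^T) = \rank (X *m diag_mx v^T).
Proof.
move=> wtv; apply/mxrank_injP/eqP.
apply/row_matrixP => i; rewrite row0; set u := row i _.
have : (u <= X *m diag_mx v^T :&: kermx M^T)%MS by apply: row_sub.
rewrite sub_capmx => /andP[/submxP[w uE] /sub_kermxP uM].
suff uT0 : u^T = 0 by apply: trmx_inj; rewrite trmx0.
apply: (@k_rank_kernel _ _ M); first by rewrite -(trmxK M) -trmx_mul uM trmx0.
apply: leq_trans wtv; apply/subset_leq_card/subsetP => r.
apply: contraLR => /suppP r0; apply/suppP.
by rewrite uE mulmxA mul_mx_diag !mxE r0 mulr0.
Qed.

End Weights.

(** * Counting rows outside a subspace *)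

Section Flats.
Variables (F : fieldType) (K : nat).

(** The canonical generator makes equal subspaces equal matrices, so that [undup] lists each
    subspace once. *)
Definition flat_join (W : 'M[F]_K) (p : 'rV[F]_K) : 'M[F]_K := <<(W + p)%MS>>%MS.

(** If a vector [x] cuts [W] out of a space containing the rows of [P], this is the weight of
    [P *m x]. Allowing any [W] makes induction on the codimension possible. *)
Definition nout (n : nat) (P : 'M[F]_(n, K)) (W : 'M[F]_K) : nat :=
  #|[set r | ~~ (row r P <= W)%MS]|.

Definition joins (W : 'M[F]_K) (n : nat) (P : 'M[F]_(n, K)) : seq 'M[F]_K :=
  undup [seq (flat_join W (row r P)) | r <- enum [set r | ~~ (row r P <= W)%MS]].

Lemma rank_join (W : 'M[F]_K) (p : 'rV[F]_K) :
  ~~ (p <= W)%MS -> \rank (W + p)%MS = (\rank W).+1.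
Proof.
move=> pW; apply/eqP; rewrite eqn_leq; apply/andP; split.
  apply: leq_trans (mxrank_adds_leqif W p) _.
  by have := rank_leq_row p; lia.
apply: rank_ltmx; rewrite ltmxE addsmxSl /=.
by apply: contra pW; apply: submx_trans; apply: addsmxSr.
Qed.

Lemma eq_join (W V : 'M[F]_K) (x : 'rV[F]_K) :
  (W <= V)%MS -> \rank V = (\rank W).+1 -> <<V>>%MS = V -> ~~ (x <= W)%MS ->
  (x <= V)%MS = (flat_join W x == V).
Proof.
move=> sWV rV genV xW; apply/idP/eqP => [xV|<-]; last first.
  by rewrite /flat_join genmxE addsmxSr.
rewrite -genV /flat_join; apply/genmxP; rewrite -(mxrank_leqif_eq _) ?rank_join ?rV //.
by rewrite addsmx_sub sWV.
Qed.

Lemma nout_join (n : nat) (X : 'M[F]_(n, K)) (W V : 'M[F]_K) :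
  (W <= V)%MS -> \rank V = (\rank W).+1 -> <<V>>%MS = V ->
  nout X W = (nout X V +
    \sum_(s in [set r | ~~ (row r X <= W)%MS]) ((flat_join W (row s X)) == V))%N.
Proof.
move=> sWV rV genV; rewrite /nout -!sum1_card (bigID (fun s => (row s X <= V)%MS)) /=.
rewrite addnC; congr addn.
  apply: eq_bigl => s; rewrite !inE andbC.
  by case: (boolP (_ <= V)%MS) => //= sV; apply: contra sV => /submx_trans; apply.
rewrite big_mkcondr /=; apply: eq_bigr => s; rewrite inE => sW.
by rewrite (eq_join sWV rV genV sW); case: eqP.
Qed.

Lemma joinsP (n : nat) (P : 'M[F]_(n, K)) (W V : 'M[F]_K) :
  reflect (exists2 r, ~~ (row r P <= W)%MS & V = (flat_join W (row r P)))
          (V \in joins W P).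
Proof.
rewrite mem_undup; apply: (iffP mapP) => -[r].
  by rewrite mem_enum inE => rW ->; exists r.
by move=> rW ->; exists r; rewrite // mem_enum inE.
Qed.

Lemma joins_flat (n : nat) (P : 'M[F]_(n, K)) (W V : 'M[F]_K) :
  V \in joins W P -> [/\ (W <= V)%MS, \rank V = (\rank W).+1 & <<V>>%MS = V].
Proof.
case/joinsP=> r rW ->; split; first by rewrite /flat_join genmxE addsmxSl.
  by rewrite /flat_join genmxE rank_join.
by rewrite /flat_join genmx_id.
Qed.

(** Double counting: [nout_join] is summed over all [V], and a row outside [W] lies in at most one
    of these [V], namely its own join with [W]. *)
Lemma sum_nout_joins (n n' : nat) (P : 'M[F]_(n, K)) (X : 'M[F]_(n', K))
    (W : 'M[F]_K) :
  (size (joins W P) * nout X W = \sum_(V <- joins W P) nout X V +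
    \sum_(s in [set r | ~~ (row r X <= W)%MS])
      ((flat_join W (row s X)) \in joins W P))%N.
Proof.
have -> : (size (joins W P) * nout X W = \sum_(V <- joins W P) nout X W)%N.
  by rewrite big_const_seq count_predT iter_addn_0 mulnC.
have uL : uniq (joins W P) by apply: undup_uniq.
under [X in _ = (_ + X)%N]eq_bigr => s _ do
  rewrite -(count_uniq_mem _ uL) -sum1_count big_mkcond /=.
rewrite exchange_big -big_split /= !big_seq; apply: eq_bigr => V.
case/joins_flat=> sWV rV genV; rewrite {1}(nout_join X sWV rV genV).
by congr addn; apply: eq_bigr => s _; rewrite eq_sym; case: eqP.
Qed.

Lemma size_joins (n : nat) (P : 'M[F]_(n, K)) (W : 'M[F]_K) :
  ((\rank W).+2 <= \rank P)%N -> (2 <= size (joins W P))%N.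
Proof.
rewrite !ltnNge; apply: contra => szL.
have [V [sWV rV PV]] : exists V : 'M[F]_K, [/\ (W <= V)%MS,
   (\rank V <= (\rank W).+1)%N & forall r, ~~ (row r P <= W)%MS -> (row r P <= V)%MS].
  case EL: (joins W P) szL => [|V [|]] // _.
    (* If there is no join, then no row of [P] lies outside [W], and [W] itself serves as [V]. *)
    exists W; split => // r rW.
    by have : (flat_join W (row r P)) \in joins W P; [apply/joinsP; exists r | rewrite EL].
  have [|sWV rV genV] := @joins_flat _ P W V; first by rewrite EL mem_head.
  exists V; split; rewrite ?rV // => r rW.
  have : (flat_join W (row r P)) \in joins W P by apply/joinsP; exists r.
  by rewrite EL inE -eq_join.
apply: leq_trans rV; apply: mxrankS; apply/row_subP => r.
by case: (boolP (row r P <= W)%MS) => [/submx_trans|/PV]; first apply.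
Qed.

(* Averaging over the flats [<W, row r P>] one dimension up: these cover the rows
   of [P] outside [W] exactly once, and those of [Q] at most once. *)
Lemma nout_le_step (n n' : nat) (P : 'M[F]_(n', K)) (Q : 'M[F]_(n, K))
    (W : 'M[F]_K) :
  ((\rank W).+2 <= \rank P)%N ->
  (forall V, V \in joins W P -> (nout Q V <= nout P V)%N) ->
  (nout Q W <= nout P W)%N.
Proof.
move=> /size_joins; set q := size _ => q2 IH.
have := sum_nout_joins P P W; have := sum_nout_joins P Q W; rewrite -/q.
have -> : (\sum_(s in [set r | ~~ (row r P <= W)%MS])
      ((flat_join W (row s P)) \in joins W P) = nout P W)%N.
  rewrite /nout -sum1_card; apply: eq_bigr => s; rewrite inE => sW.
  by have -> : (flat_join W (row s P)) \in joins W P by apply/joinsP; exists s.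
have : (\sum_(s in [set r | ~~ (row r Q <= W)%MS])
      ((flat_join W (row s Q)) \in joins W P) <= nout Q W)%N.
  by rewrite /nout -sum1_card; apply: leq_sum => s _; case: (_ \in _).
have : (\sum_(V <- joins W P) nout Q V <= \sum_(V <- joins W P) nout P V)%N.
  by rewrite !big_seq; apply: leq_sum.
(* The sum of [nout P V] is [(q - 1) * nout P W], while that of [nout Q V] is at least
   [(q - 1) * nout Q W]; [q2] permits division by [q - 1]. *)
nia.
Qed.

Lemma col_mul (m n p : nat) (A : 'M[F]_(m, n)) (B : 'M[F]_(n, p)) (j : 'I_p) :
  col j (A *m B) = A *m col j B.
Proof. by rewrite !colE mulmxA. Qed.

Lemma separating_vector (m : nat) (u : 'rV[F]_K) (W : 'M[F]_(m, K)) :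
  ~~ (u <= W)%MS -> exists2 x : 'cV[F]_K, W *m x = 0 & u *m x != 0.
Proof.
rewrite submxE => uW.
have [j uj] : exists j, (u *m cokermx W) 0 j != 0.
  apply/existsP; apply: contraR uW; rewrite negb_exists => /forallP u0.
  by apply/eqP/rowP => j; rewrite [RHS]mxE; apply/eqP; rewrite -[_ == _]negbK.
exists (col j (cokermx W)).
  by rewrite -col_mul mulmx_coker; apply/colP=> i; rewrite !mxE.
by rewrite -col_mul; apply: contra uj => /eqP/colP/(_ 0); rewrite !mxE => ->.
Qed.

(** A vector that kills [W] but not some row of [P] outside [W] suffices, since [W] and that row
    span the row space of [P]. *)
Lemma hyperplane_vector (n : nat) (P : 'M[F]_(n, K)) (W : 'M[F]_K) :
  (W <= P)%MS -> \rank P = (\rank W).+1 ->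
  exists x : 'cV[F]_K,
    forall v : 'rV[F]_K, (v <= P)%MS -> (v *m x == 0) = (v <= W)%MS.
Proof.
move=> sWP rP.
have /row_subPn[r rW] : ~~ (P <= W)%MS.
  by apply/negP => /mxrankS; rewrite rP ltnn.
have [x Wx ux] := separating_vector rW; exists x => v vP.
apply/idP/idP => [/eqP vx0|/submxP[D ->]]; last by rewrite -mulmxA Wx mulmx0.
have : (v <= W + row r P)%MS.
  apply: submx_trans vP _; rewrite -(mxrank_leqif_sup _) ?rank_join ?rP //.
  by rewrite addsmx_sub sWP row_sub.
case/sub_addsmxP=> -[a b] /= vE; move/eqP: vx0; rewrite vE mulmxDl -mulmxA Wx.
rewrite mulmx0 add0r [b]mx11_scalar mul_scalar_mx -scalemxAl scaler_eq0 (negPf ux).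
by rewrite orbF => /eqP->; rewrite scale0r addr0 submxMl.
Qed.

Lemma row_mul_eq0 (n : nat) (P : 'M[F]_(n, K)) (x : 'cV[F]_K) (r : 'I_n) :
  (row r P *m x == 0) = (r \notin supp (P *m x)).
Proof.
rewrite -row_mul inE negbK; apply/eqP/eqP => [/rowP/(_ 0)|r0].
  by rewrite !mxE.
by apply/rowP => i; rewrite ord1 [LHS]mxE r0 mxE.
Qed.

(** * The inequality behind the permutation lemma *)

Section Permutation.
Variables (n n' : nat) (P : 'M[F]_(n', K)) (Q : 'M[F]_(n, K)).
Hypothesis le_n'n : (n' <= n)%N.
Hypothesis supp_le : forall x : 'cV[F]_K,
  (#|supp (P *m x)| + \rank Q <= n.+1)%N ->
  (#|supp (Q *m x)| <= #|supp (P *m x)|)%N.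

(** A vector killing every row of [P] has weight zero there, which meets the bound in [supp_le]
    because [\rank Q <= n]; hence it kills every row of [Q]. The columns of [cokermx P] are such
    vectors. *)
Lemma supp_le_submx : (Q <= P)%MS.
Proof.
rewrite submxE; apply/eqP/matrixP => i j.
have := @supp_le (col j (cokermx P)); rewrite -col_mul mulmx_coker.
have -> : supp (col j (0 : 'M[F]_(n', K))) = set0.
  by apply/setP=> r; rewrite !inE !mxE eqxx.
rewrite cards0 leqn0 add0n => /(_ (leq_trans (rank_leq_row _) (leqnSn _))).
rewrite cards_eq0 -col_mul => /eqP s0.
by have := in_set0 i; rewrite -s0 => /negbT/suppP; rewrite !mxE.
Qed.

Lemma nout_supp (x : 'cV[F]_K) (W : 'M[F]_K) (k : nat) (X : 'M[F]_(k, K)) :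
  (forall v : 'rV[F]_K, (v <= P)%MS -> (v *m x == 0) = (v <= W)%MS) ->
  (X <= P)%MS -> nout X W = #|supp (X *m x)|.
Proof.
move=> xW sXP; apply: eq_card => r.
by rewrite inE -xW ?row_mul_eq0 ?negbK // (submx_trans (row_sub _ _)).
Qed.

(** Induction on the codimension of [W] in the row space of [P]: codimension 0 is [supp_le_submx],
    codimension 1 is [supp_le], and larger codimensions follow by averaging. *)
Lemma nout_le (W : 'M[F]_K) : (W <= P)%MS -> (\rank W + nout P W <= n')%N ->
  (nout Q W <= nout P W)%N.
Proof.
move=> sWP; have [k] := ubnP (\rank P - \rank W).
elim: k W sWP => // k IHk W sWP ltk WP.
have rW := mxrankS sWP.
have [rP|] := ltnP (\rank W).+1 (\rank P).
  apply: nout_le_step => // V VL; have [sWV rV genV] := joins_flat VL.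
  have [r rNW VE] := joinsP _ _ _ VL.
  apply: IHk; first by rewrite VE /flat_join genmxE addsmx_sub sWP row_sub.
    by rewrite rV; lia.
  (* The bound passes from [W] to [V]: the rank grows by one, but row [r] is no longer outside. *)
  rewrite rV; move: WP; rewrite (nout_join P sWV rV genV) (bigD1 r) ?inE //=.
  by rewrite VE eqxx; lia.
rewrite leq_eqVlt => /orP[/eqP rP|]; last first.
  rewrite ltnS => leP; suff -> : nout Q W = 0%N by [].
  apply: eq_card0 => r; rewrite inE; apply/negbTE; rewrite negbK.
  have sPW : (P <= W)%MS by rewrite -(mxrank_leqif_sup sWP) eqn_leq rW.
  by rewrite (submx_trans (row_sub _ _)) // (submx_trans supp_le_submx).
have [x xW] := hyperplane_vector sWP rP.
have := mxrankS supp_le_submx => rQ.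
rewrite (nout_supp xW supp_le_submx) (nout_supp xW (submx_refl P)).
(* Here [\rank W] is [\rank P - 1], so [n' <= n] and [\rank Q <= \rank P] turn the bound on
   [nout P W] into the one in [supp_le]. *)
by apply: supp_le; rewrite -(nout_supp xW (submx_refl P)); lia.
Qed.

(** The case [W = 0] of [nout_le]: all rows of [Q] lie outside the zero space. This later bounds the
    tensor rank from below. *)
Lemma rows_le : (forall r, row r Q != 0) -> (n <= n')%N.
Proof.
move=> Q0; have := nout_le (sub0mx _ P); rewrite mxrank0 add0n.
have -> : nout Q 0 = n.
  rewrite -[RHS]card_ord; apply: eq_card => r; rewrite !inE submx0; exact: Q0.
have le : (nout P 0 <= n')%N by rewrite -[leqRHS]card_ord max_card.
by move=> /(_ le) nle; apply: leq_trans nle le.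
Qed.

End Permutation.

Lemma nout_add (n : nat) (P : 'M[F]_(n, K)) (W : 'M[F]_K) :
  (nout P W + #|[set r | (row r P <= W)%MS]| = n)%N.
Proof.
rewrite addnC -[RHS](card_ord n) -(cardsC [set r | (row r P <= W)%MS]); congr addn.
by apply: eq_card => r; rewrite !inE.
Qed.

(* Kruskal's permutation lemma *)
Lemma permutation_lemma (n : nat) (P Q : 'M[F]_(n, K)) :
  (forall r, row r P != 0) -> (forall r, row r Q != 0) ->
  (forall r s, (row r Q <= row s Q)%MS -> r = s) ->
  (forall x : 'cV[F]_K, (#|supp (P *m x)| + \rank Q <= n.+1)%N ->
     (#|supp (Q *m x)| <= #|supp (P *m x)|)%N) ->
  exists (s : {perm 'I_n}) (l : 'I_n -> F),
    forall r, l r != 0 /\ row r P = l r *: row (s r) Q.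
Proof.
move=> P0 Q0 Qinj supp_le.
pose L r : 'M[F]_K := <<row r P>>%MS.
(* [nout_le] applies to the line [L r]: it has rank 1 and contains row [r] of [P], so at most
   [n - 1] rows of [P] lie outside. Taking complements reverses the inequality. *)
have le_in r : (#|[set t | (row t P <= L r)%MS]| <= #|[set t | (row t Q <= L r)%MS]|)%N.
  have PL := nout_add P (L r).
  have : (nout Q (L r) <= nout P (L r))%N.
    apply: (nout_le (leqnn _) supp_le); first by rewrite genmxE row_sub.
    have r_in : (0 < #|[set t | (row t P <= L r)%MS]|)%N.
      by apply/card_gt0P; exists r; rewrite inE genmxE.
    rewrite genmxE rank_rV P0; lia.
  have := nout_add Q (L r); lia.
have QP (t r : 'I_n) : (row t Q <= L r)%MS ->
    exists2 a, a != 0 & row r P = a *: row t Q.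
  rewrite genmxE => /sub_rVP[a tE]; exists a^-1.
    rewrite invr_eq0; apply: contra (Q0 t); rewrite tE => /eqP->.
    by rewrite scale0r.
  rewrite tE scalerA mulVf ?scale1r //; apply: contra (Q0 t); rewrite tE => /eqP->.
  by rewrite scale0r.
have in1 r : (#|[set t | (row t Q <= L r)%MS]| <= 1)%N.
  apply/card_le1_eqP => t u; rewrite !inE => tL uL; apply: Qinj.
  have [a _ aE] := QP _ _ tL; apply: (submx_trans uL); rewrite genmxE aE.
  exact: scalemx_sub.
have ex r : exists t, (row t Q <= L r)%MS.
  have /card_gt0P[t] : (0 < #|[set t | (row t Q <= L r)%MS]|)%N.
    apply: leq_trans (le_in r); apply/card_gt0P; exists r.
    by rewrite inE genmxE.
  by rewrite inE; exists t.
pose f r := xchoose (ex r).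
have fP r : (row (f r) Q <= L r)%MS := xchooseP (ex r).
have f_inj : injective f.
  (* If [f r = f t], rows [r] and [t] of [P] lie on one line, which holds at most one row of [Q] and
     hence at most one of [P]. *)
  move=> r t ft; have := leq_trans (le_in r) (in1 r) => /card_le1_eqP; apply.
    rewrite inE; have [a _ ->] := QP _ _ (fP t); rewrite -ft.
    exact: scalemx_sub.
  by rewrite inE genmxE.
have /fin_all_exists2[l l0 lE] (r : 'I_n) : exists2 a, a != 0 & row r P = a *: row (f r) Q.
  exact: QP.
by exists (perm f_inj), l => r; rewrite permE.
Qed.

End Flats.

(** * Generic vectors and recovery of the first two factors *)

Section Factors.
Variable F : fieldType.
Hypothesis F_char0 : [pchar F] =i pred0.

(** In characteristic zero the images of [0, ..., size p - 1] are distinct, too many to be all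
    roots. *)
Lemma exists_nonroot (p : {poly F}) : p != 0 -> exists t, ~~ root p t.
Proof.
move=> p0; pose s := [seq i%:R : F | i <- iota 0 (size p)].
have [/allPn[t _ rt]|/negPn all_root] := boolP (~~ all (root p) s).
  by exists t.
suff us : uniq s by have := max_poly_roots p0 all_root us; rewrite size_map size_iota ltnn.
have pF := (pcharf0P F).1 F_char0.
have inj i j : (i <= j)%N -> i%:R = j%:R :> F -> i = j.
  move=> leij /eqP; rewrite eq_sym -subr_eq0 -natrB // pF subn_eq0 => leji.
  by apply/eqP; rewrite eqn_leq leij.
rewrite map_inj_uniq ?iota_uniq // => i j.
by case/orP: (leq_total i j) => [/inj|/inj ji /esym/ji].
Qed.

(** A space over an infinite field is not a finite union of proper subspaces. Inductively, [x] works
    for [s], [y] works for [u], and [x + t *: y] works for both unless [t] is one of finitely many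
    values. *)
Lemma generic_vector (m K : nat) (W : 'M[F]_(m, K)) (s : seq 'rV[F]_K) :
  all (fun u => ~~ (u <= W)%MS) s ->
  exists2 x : 'cV[F]_K, W *m x = 0 & all (fun u => u *m x != 0) s.
Proof.
elim: s => [_|u s IHs /= /andP[uW sW]]; first by exists 0; rewrite ?mulmx0.
have [x Wx sx] := IHs sW; have [y Wy uy] := separating_vector uW.
have neq0 (c : 'M[F]_1) : (c != 0) = (c 0 0 != 0).
  congr negb; apply/eqP/eqP => [->|c0]; first by rewrite mxE.
  by apply/matrixP => i j; rewrite !ord1 c0 mxE.
(* This is [v *m (x + t *: y)] as a polynomial in [t]. *)
pose q (v : 'rV[F]_K) := ((v *m y) 0 0)%:P * 'X + ((v *m x) 0 0)%:P.
have q0 v : (v *m y != 0) || (v *m x != 0) -> q v != 0.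
  apply: contraL => /eqP qv; have := congr1 (coefp 0) qv; have := congr1 (coefp 1) qv.
  rewrite /= !coefD !coefMX !coefC /= addr0 add0r negb_or !neq0 => -> ->.
  by rewrite eqxx.
have [|t] := @exists_nonroot (\prod_(v <- u :: s) q v).
  rewrite prodf_seq_neq0; apply/allP => v /=; rewrite inE => /predU1P[->|vs].
    by apply: q0; rewrite uy.
  by apply: q0; rewrite (allP sx) ?orbT.
rewrite rootE horner_prod prodf_seq_neq0 => /allP nroot; exists (x + t *: y).
  by rewrite mulmxDr Wx -scalemxAr Wy scaler0 addr0.
apply/(@allP _ _ (u :: s)) => v /nroot; apply: contra => /eqP v0.
rewrite /q !hornerE; apply/eqP; move/matrixP/(_ 0 0): v0.
by rewrite mulmxDr -scalemxAr !mxE => v0; rewrite mulrC addrC.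
Qed.

(** A column of [C] indexed by [U] is not in the span of those outside [U], since such a relation
    would involve at most [R - #|U| + 1 <= k_rank C] columns. A generic vector killing the latter
    columns then misses each of the former. *)
Lemma exists_supp (K R : nat) (C : 'M[F]_(K, R)) (U : {set 'I_R}) :
  (R < #|U| + k_rank C)%N -> exists x : 'cV[F]_K, supp (C^T *m x) = U.
Proof.
(* [E] indicates the complement of [U], so [diag_mx E *m C^T] keeps exactly the columns that [x] has
   to kill. *)
move=> kC; pose E : 'rV[F]_R := \row_r (r \notin U)%:R.
have [|x Wx Ux] := @generic_vector _ _ (diag_mx E *m C^T) [seq row r C^T | r <- enum U].
  apply/allP => u /mapP[r]; rewrite mem_enum => rU ->.
  apply/negP => /submxP[w]; rewrite mulmxA => rE.
  pose v : 'cV[F]_R := (delta_mx 0 r - w *m diag_mx E)^T.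
  have vE t : v t 0 = (t == r)%:R - w 0 t * (t \notin U)%:R.
    by rewrite /v mul_mx_diag !mxE ?eqxx ?andbT.
  suff v0 : v = 0.
    by have := vE r; rewrite v0 mxE eqxx rU mulr0 subr0 => /eqP; rewrite eq_sym oner_eq0.
  apply: (@k_rank_kernel _ _ _ C).
    by apply: trmx_inj; rewrite trmx_mul trmxK mulmxBl -rE -rowE subrr trmx0.
  have: (#|supp v| <= #|r |: ~: U|)%N.
    apply/subset_leq_card/subsetP => t; apply: contraLR.
    rewrite !inE negb_or !negbK => /andP[tr tU].
    by rewrite vE (negPf tr) tU mulr0 subr0.
  rewrite cardsU1 !inE rU /=; have := cardsC U; rewrite card_ord => cU lev.
  by apply: leq_trans lev _; rewrite -(leq_add2l #|U|) addnCA cU.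
exists x; apply/setP => r; apply/idP/idP; last first.
  move=> rU; have := allP Ux (row r C^T); rewrite row_mul_eq0 negbK; apply.
  by apply/mapP; exists r; rewrite ?mem_enum.
apply: contraLR => rU; apply/suppP.
by move/colP/(_ r): Wx; rewrite -mulmxA mul_diag_mx !mxE rU mul1r.
Qed.

Lemma diag_mulmx_sub (R J : nat) (v : 'cV[F]_R) (B : 'M[F]_(J, R)) (w : 'rV[F]_J) :
  (w <= diag_mx v^T *m B^T)%MS ->
  exists2 z : 'cV[F]_R, supp z \subset supp v & B *m z = w^T.
Proof.
case/submxP=> D ->; exists (D *m diag_mx v^T)^T; last first.
  by rewrite mulmxA [RHS]trmx_mul trmxK.
apply/subsetP => r; apply: contraLR => /suppP r0; apply/suppP.
by rewrite mul_mx_diag !mxE r0 mulr0.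
Qed.

(** With [u = R + 1 - k_rank C], the smallest support size given by [exists_supp], the hypotheses
    read [u <= k_rank A] and [u + 1 <= k_rank B]. The extra unit for [B] serves to compare two index
    sets that differ by one exchange. *)
Lemma factors_unique (I J K R : nat) (A A' : 'M[F]_(I, R)) (B B' : 'M[F]_(J, R))
    (C : 'M[F]_(K, R)) :
  (R.+1 <= k_rank A + k_rank C)%N -> (R.+2 <= k_rank B + k_rank C)%N ->
  (forall x : 'cV[F]_K, A *m diag_mx (C^T *m x)^T *m B^T =
     A' *m diag_mx (C^T *m x)^T *m B'^T) ->
  exists b : 'I_R -> F,
    forall r, col r B' = b r *: col r B /\ col r A = b r *: col r A'.
Proof.
move=> kA kB eqM; have kA_le := k_rank_le A; have kB_le := k_rank_le B.
have kC_le := k_rank_le C.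
pose u := (R.+1 - k_rank C)%N.
have inU (U : {set 'I_R}) r : #|U| = u -> r \in U ->
    exists2 z : 'cV[F]_R, supp z \subset U & B *m z = col r B'.
  move=> cardU rU; have [|x xU] := @exists_supp _ _ C U; first by rewrite cardU; lia.
  move: (eqM x) xU; move: (C^T *m x) => v eqMx xU; rewrite -xU.
  have cardv : #|supp v| = u by rewrite xU.
  have rM : \rank (A *m diag_mx v^T *m B^T) = \rank (diag_mx v^T).
    rewrite rank_mul_diag_tr ?cardv; last lia.
    rewrite -mxrank_tr trmx_mul tr_diag_mx -[diag_mx v^T]mul1mx.
    by rewrite rank_mul_diag_tr // cardv; lia.
  (* The row space of the slice lies in that of [diag_mx v^T *m B'^T], whose rank is at most
     [\rank (diag_mx v^T)], the rank of the slice. So the two row spaces agree, and the slice also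
     lies in the row space of [diag_mx v^T *m B^T]. *)
  have sub : (diag_mx v^T *m B'^T <= diag_mx v^T *m B^T)%MS.
    apply: (@submx_trans _ _ _ _ _ _ (A *m diag_mx v^T *m B^T)); last first.
      by rewrite -mulmxA submxMl.
    rewrite -(mxrank_leqif_sup _); last by rewrite eqMx -mulmxA submxMl.
    rewrite eqn_leq rM mxrankM_maxl andbT -rM eqMx -mulmxA mxrankM_maxr //.
  rewrite -[col r B']trmxK tr_col; apply: diag_mulmx_sub; apply: submx_trans sub.
  have vr : v r 0 != 0 by move: rU; rewrite -xU inE.
  have -> : row r B'^T = (v r 0)^-1 *: row r (diag_mx v^T *m B'^T).
    by apply/rowP => j; rewrite mul_diag_mx !mxE mulKf.
  by rewrite scalemx_sub ?row_sub.
have /fin_all_exists[b bE] r : exists br, col r B' = br *: col r B.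
  have [|U rU cardU] := @card_superset _ [set r] u.
    by rewrite cards1 card_ord; lia.
  rewrite sub1set in rU; have [z zU zE] := inU U r cardU rU.
  (* Exchanging [s] for some [t] outside [U] gives a second expression [y] of the same column. The
     difference [y - z] is supported on [u + 1] indices, so [y = z], and [y] has no coefficient at
     [s]. *)
  have z1 s : s != r -> z s 0 = 0.
    move=> sr; apply/suppP/negP => sz; have sU := subsetP zU _ sz.
    have /set0Pn[t] : ~: U != set0.
      by rewrite -card_gt0; have := cardsC U; rewrite card_ord; lia.
    rewrite inE => tU.
    have [||y yV yE] := inU (t |: U :\ s) r.
    - by rewrite cardsU1 !inE (negPf tU) andbF /= -cardU (cardsD1 s U) sU.
    - by rewrite !inE rU [r == s]eq_sym sr orbT.
    have yz : y - z = 0.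
      apply: (@k_rank_kernel _ _ _ B); first by rewrite mulmxBr yE zE subrr.
      have: (#|supp (y - z)| <= #|t |: U|)%N.
        apply/subset_leq_card/subsetP => i; apply: contraLR => iU; apply/suppP.
        have /suppP yi : i \notin supp y.
          apply: contra iU => /(subsetP yV); rewrite !inE => /orP[->//|].
          by case/andP=> _ ->; rewrite orbT.
        have /suppP zi : i \notin supp z.
          by apply: contra iU => /(subsetP zU); rewrite !inE => ->; rewrite orbT.
        by rewrite !mxE yi zi subrr.
      by rewrite cardsU1 tU cardU; lia.
    have /suppP ys : s \notin supp y.
      apply/negP => /(subsetP yV); rewrite !inE eqxx /= orbF => /eqP st.
      by move: tU; rewrite -st sU.
    move: sz; rewrite inE; move/colP/(_ s): yz; rewrite !mxE ys sub0r => /eqP.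
    by rewrite oppr_eq0 => ->.
  exists (z r 0); rewrite -zE; apply/colP => j; rewrite !mxE (bigD1 r) //= big1.
    by rewrite addr0 mulrC.
  by move=> s /z1->; rewrite mulr0.
exists b => r; split => //.
have [|U rU cardU] := @card_superset _ [set r] u.
  by rewrite cards1 card_ord; lia.
rewrite sub1set in rU.
have [|x xU] := @exists_supp _ _ C U; first by rewrite cardU; lia.
(* Substituting [bE] in the slice identity leaves a product with [B^T], which cancels since the
   weight [u] is at most [k_rank B]; column [r] then gives the claim because [r] is in the
   support. *)
have /eqP : (A - A' *m diag_mx (\row_s b s)) *m diag_mx (C^T *m x)^T *m B^T = 0.
  rewrite !mulmxBl eqM -!mulmxA; apply/eqP; rewrite subr_eq0; apply/eqP.
  congr (_ *m _); rewrite mulmxA diag_mxC -mulmxA; congr (_ *m _).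
  rewrite mul_diag_mx; apply/matrixP => s j; rewrite !mxE.
  by move/colP/(_ j): (bE s); rewrite !mxE.
rewrite -mxrank_eq0 rank_mul_diag_tr ?xU ?cardU; last lia.
rewrite mxrank_eq0 mul_mx_diag => /eqP/matrixP Z; apply/colP => i.
have := Z i r; rewrite mul_mx_diag !mxE => /eqP. rewrite mulf_eq0. rewrite subr_eq0.
have : (C^T *m x) r 0 != 0 by move: rU; rewrite -xU inE.
by rewrite mxE => /negPf->; rewrite orbF => /eqP->; rewrite mulrC.
Qed.

End Factors.

(** * Comparison of two decompositions *)

Section Uniqueness.
Variables (F : fieldType) (I J K : nat).

(** Contracting the third mode with [x] yields a matrix that depends on [T] alone, so any two
    decompositions of [T] share it. *)
Lemma PD_slice (T : tensor F I J K) (R : nat) (A : 'M[F]_(I, R))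
    (B : 'M[F]_(J, R)) (C : 'M[F]_(K, R)) (x : 'cV[F]_K) :
  is_PD T A B C ->
  A *m diag_mx (C^T *m x)^T *m B^T = \matrix_(i, j) \sum_k T (i, j, k) * x k 0.
Proof.
case=> _ _ _ ->; apply/matrixP => i j; rewrite mul_mx_diag !mxE.
under [RHS]eq_bigr => k _ do rewrite sum_ffunE mulr_suml.
rewrite exchange_big; apply: eq_bigr => r _.
rewrite !mxE mulrAC mulr_sumr; apply: eq_bigr => k _.
by rewrite ffunE !mxE mulrA.
Qed.

(** Column form of equality up to permutation and scaling; the product condition also forces all
    scalars to be nonzero. *)
Definition same_terms (R : nat) (A A' : 'M[F]_(I, R)) (B B' : 'M[F]_(J, R))
    (C C' : 'M[F]_(K, R)) : Prop :=
  exists (s : {perm 'I_R}) (a b c : 'I_R -> F), forall r,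
    [/\ a r * b r * c r = 1, col r A' = a r *: col (s r) A,
        col r B' = b r *: col (s r) B & col r C' = c r *: col (s r) C].

(** This compares two arbitrary decompositions through a common one: the first matching is inverted
    and composed with the second. *)
Lemma same_terms_trans (R : nat) (A A1 A2 : 'M[F]_(I, R)) (B B1 B2 : 'M[F]_(J, R))
    (C C1 C2 : 'M[F]_(K, R)) :
  same_terms A A1 B B1 C C1 -> same_terms A A2 B B2 C C2 ->
  same_terms A1 A2 B1 B2 C1 C2.
Proof.
case=> s [a [b [c H1]]] [s' [a' [b' [c' H2]]]].
pose t := (s' * s^-1)%g; have st r : s (t r) = s' r by rewrite permM permKV.
exists t, (fun r => a' r / a (t r)), (fun r => b' r / b (t r)),
  (fun r => c' r / c (t r)) => r.
have [abc -> -> ->] := H1 (t r); have [abc' -> -> ->] := H2 r; rewrite st.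
have := oner_eq0 F; rewrite -{1}abc !mulf_eq0 => /norP[/norP[a0 b0] c0].
rewrite !scalerA !divfK //; split=> //.
by rewrite !mulf_div abc abc' divr1.
Qed.

Lemma same_terms_matrices (R : nat) (A A' : 'M[F]_(I, R)) (B B' : 'M[F]_(J, R))
    (C C' : 'M[F]_(K, R)) : same_terms A A' B B' C C' ->
  exists Pi LA LB LC : 'M[F]_R,
    [/\ is_perm_mx Pi,
        [/\ is_diag_mx LA, is_diag_mx LB & is_diag_mx LC],
        [/\ LA \in unitmx, LB \in unitmx & LC \in unitmx],
        [/\ A' = A *m Pi *m LA, B' = B *m Pi *m LB & C' = C *m Pi *m LC]
      & LA *m LB *m LC = 1%:M].
Proof.
case=> s [a [b [c H]]].
have nz r : [/\ a r != 0, b r != 0 & c r != 0].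
  have [abc _ _ _] := H r.
  by have := oner_eq0 F; rewrite -{1}abc !mulf_eq0 => /norP[/norP[]].
have unit_diag (f : 'I_R -> F) : (forall r, f r != 0) ->
    diag_mx (\row_r f r) \in unitmx.
  move=> f0; rewrite unitmxE det_diag unitfE; apply/prodf_neq0 => r _.
  by rewrite mxE.
have scale m (X X' : 'M[F]_(m, R)) (f : 'I_R -> F) :
    (forall r, col r X' = f r *: col (s r) X) ->
    X' = X *m perm_mx s^-1 *m diag_mx (\row_r f r).
  move=> XE; rewrite -col_permE mul_mx_diag; apply/matrixP => i r; rewrite !mxE.
  by move/colP/(_ i): (XE r); rewrite !mxE mulrC.
exists (perm_mx s^-1), (diag_mx (\row_r a r)), (diag_mx (\row_r b r)),
  (diag_mx (\row_r c r)); split.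
- exact: perm_mx_is_perm.
- by split; apply: diag_mx_is_diag.
- by split; apply: unit_diag => r; case: (nz r).
- by split; apply: scale => r; case: (H r).
- rewrite !mulmx_diag -diag_const_mx; congr diag_mx; apply/rowP => r.
  by rewrite !mxE; case: (H r).
Qed.

Hypothesis F_char0 : [pchar F] =i pred0.

Lemma unique_terms (R : nat) (T : tensor F I J K)
    (A A' : 'M[F]_(I, R)) (B B' : 'M[F]_(J, R)) (C C' : 'M[F]_(K, R))
    (s : {perm 'I_R}) (c : 'I_R -> F) :
  is_PD T A B C -> is_PD T A' B' C' ->
  (forall r, c r != 0 /\ col r C' = c r *: col (s r) C) ->
  (R.+1 <= k_rank A + k_rank C)%N -> (R.+1 <= k_rank B + k_rank C)%N ->
  (R.+2 <= k_rank A + k_rank C)%N \/ (R.+2 <= k_rank B + k_rank C)%N ->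
  same_terms A A' B B' C C'.
Proof.
move=> hT hT' hC kA kB kAB; have [A0 B0 _ _] := hT; have [A0' B0' _ _] := hT'.
(* moving the scalars [c] and the permutation [s] onto the first factor *)
pose A1 := \matrix_(i, r) (c ((s^-1)%g r) * A' i ((s^-1)%g r)).
pose B1 := \matrix_(i, r) B' i ((s^-1)%g r).
have eqM x : A *m diag_mx (C^T *m x)^T *m B^T = A1 *m diag_mx (C^T *m x)^T *m B1^T.
  rewrite (PD_slice x hT) -(PD_slice x hT'); apply/matrixP => i j.
  rewrite !mul_mx_diag !mxE [RHS](reindex_inj (@perm_inj _ s)).
  apply: eq_bigr => r _; rewrite !mxE permK; congr (_ * _); rewrite -mulrA mulrCA.
  congr (_ * _); rewrite mulr_sumr; apply: eq_bigr => k _; rewrite !mxE mulrA.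
  by have [_ /colP/(_ k)] := hC r; rewrite !mxE => ->.
have A1E r : col (s r) A1 = c r *: col r A' by apply/colP => i; rewrite !mxE permK.
have B1E r : col (s r) B1 = col r B' by apply/colP => i; rewrite !mxE permK.
have [b bE] : exists b : 'I_R -> F, forall r, [/\ b r != 0,
    col r B1 = b r *: col r B & col r A = b r *: col r A1].
  case: kAB => k2; last first.
    have [b bE] := factors_unique F_char0 kA k2 eqM; exists b => r.
    have [B1b Ab] := bE r; split=> //; apply: contra (A0 r); rewrite Ab => /eqP->.
    by rewrite scale0r.
  (* Transposing the slices exchanges the roles of [A] and [B], which is why the scalars appear
     inverted below. *)
  have [|b bE] := @factors_unique _ F_char0 _ _ _ _ B B1 A A1 C kB k2.
    move=> x; move: (C^T *m x) (eqM x) => w eqMw; apply: trmx_inj.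
    by move: eqMw; rewrite !(trmx_mul _ _^T) !trmxK !(trmx_mul _ (diag_mx _)) !tr_diag_mx !mulmxA.
  exists (fun r => (b r)^-1) => r; have [A1b Bb] := bE r.
  have br : b r != 0 by apply: contra (B0 r); rewrite Bb => /eqP->; rewrite scale0r.
  by rewrite A1b Bb !scalerA mulVf // !scale1r invr_eq0.
exists s, (fun r => (c r * b (s r))^-1), (fun r => b (s r)), c => r.
have [cr Cr] := hC r; have [br Br Ar] := bE (s r); split => //.
- by rewrite invfM mulrC mulrA mulrA mulfV // mul1r mulVf.
- by rewrite Ar A1E !scalerA mulrAC -mulrA mulVf ?scale1r // mulf_neq0.
- by rewrite -B1E.
Qed.

(** The common slice has rank at least [Hfun A B] at the weight of [C^T *m x] and at most the weight
    of [C'^T *m x]. This supplies the hypothesis [supp_le] of the permutation argument. *)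
Lemma supp_le_of_Hfun (R R' : nat) (T : tensor F I J K)
    (A : 'M[F]_(I, R)) (B : 'M[F]_(J, R)) (C : 'M[F]_(K, R))
    (A' : 'M[F]_(I, R')) (B' : 'M[F]_(J, R')) (C' : 'M[F]_(K, R')) (x : 'cV[F]_K) :
  is_PD T A B C -> is_PD T A' B' C' ->
  (forall delta : nat, (1 <= delta <= R)%N ->
     Num.min delta%:Z (m_index C) <= Hfun A B delta) ->
  (#|supp (C'^T *m x)| + \rank C^T <= R.+1)%N ->
  (#|supp (C^T *m x)| <= #|supp (C'^T *m x)|)%N.
Proof.
move=> hT hT' hH; rewrite mxrank_tr => wt.
have [->//|supp_gt0] := posnP #|supp (C^T *m x)|.
have := hH #|supp (C^T *m x)|; rewrite supp_gt0 -[leqRHS]card_ord max_card => /(_ isT).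
move=> /le_trans/(_ (Hfun_le_rank A (C^T *m x) B)).
rewrite (PD_slice x hT) -(PD_slice x hT') => H.
have := rank_diag_le A' (C'^T *m x) B'.
rewrite -lez_nat => /(le_trans H); rewrite /m_index ge_min lez_nat => /orP[//|].
(* The bound [wt] says that the weight of [C'^T *m x] is at most [m_index C - 1], which excludes the
   other branch of the minimum. *)
move: wt; move: #|_| (\rank _) => p q; lia.
Qed.

End Uniqueness.

Theorem corollary1p24 (RR : realType) (F : fieldType)
    (hF : real_or_complex RR F) (I J K R : nat) (T : tensor F I J K)
    (A : 'M[F]_(I, R)) (B : 'M[F]_(J, R)) (C : 'M[F]_(K, R))
    (hT : is_PD T A B C)
    (h1 : R%:Z + 1 <=
       Num.max (Num.min (k_rank A)%:Z ((k_rank B)%:Z - 1))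
               (Num.min ((k_rank A)%:Z - 1) (k_rank B)%:Z)
       + (k_rank C)%:Z)
    (h2 : forall delta : nat, (1 <= delta <= R)%N ->
       Num.min delta%:Z (m_index C) <= Hfun A B delta) :
  tensor_rank T = R /\ CPD_unique T.
Proof.
have F_char0 : [pchar F] =i pred0 by case: hF; apply: pchar_num.
(* Either branch of the maximum in (i) gives both inequalities with [R.+1], and one of them with
   [R.+2]. *)
have [kA kB kAB] : [/\ (R.+1 <= k_rank A + k_rank C)%N,
    (R.+1 <= k_rank B + k_rank C)%N &
    (R.+2 <= k_rank A + k_rank C)%N \/ (R.+2 <= k_rank B + k_rank C)%N].
  by move: h1; move: (k_rank A) (k_rank B) (k_rank C) => a b c; split; lia.
have [_ _ C0 _] := hT.
have row_neq0 n (X : 'M[F]_(K, n)) r : col r X != 0 -> row r X^T != 0.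
  by rewrite -tr_col; apply: contra => /eqP/(congr1 trmx); rewrite trmxK trmx0 => ->.
have rankT : tensor_rank T = R.
  rewrite /tensor_rank; case: ex_minnP => R' /asboolP[A' [B' [C' hT']]] minR'.
  have R'R : (R' <= R)%N by apply: minR'; apply/asboolP; exists A, B, C.
  apply/eqP; rewrite eqn_leq R'R /=.
  (* Minimality gave [R' <= R], which is what the counting argument requires in order to return
     [R <= R']. *)
  apply: (@rows_le _ _ _ _ C'^T C^T R'R) => [x|r]; last exact: row_neq0.
  exact: (supp_le_of_Hfun hT hT' h2).
split=> // R0 A1 A2 B1 B2 C1 C2 [R0E hT1] [_ hT2].
rewrite rankT in R0E; subst R0.
have rows_indep r s : (row r C^T <= row s C^T)%MS -> r = s.
  case/sub_rVP=> a rE; apply/eqP/negPn/negP => rs.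
  (* One of [k_rank A], [k_rank B] plus [k_rank C] is at least [R + 2], and neither of the first two
     exceeds [R]. Hence no two columns of [C] are proportional. *)
  have kC : (2 <= k_rank C)%N.
    by have := k_rank_le A; have := k_rank_le B; lia.
  pose v : 'cV[F]_R := delta_mx r 0 - a *: delta_mx s 0.
  have /colP/(_ r) : v = 0.
    apply: (@k_rank_kernel _ _ _ C).
      rewrite mulmxBr -scalemxAr -!colE; apply: trmx_inj.
      by rewrite linearB linearZ /= !tr_col rE subrr trmx0.
    apply: leq_trans kC; rewrite -[2%N]/(true.+1) -rs -cards2.
    apply/subset_leq_card/subsetP => t; rewrite !inE; apply: contraR.
    rewrite negb_or !mxE => /andP[/negPf-> /negPf->].
    by rewrite mulr0 subr0.
  by rewrite !mxE !eqxx (negPf rs) mulr0 subr0 => /eqP; rewrite oner_eq0.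
have terms A' B' C' : is_PD T A' B' C' -> same_terms A A' B B' C C'.
  move=> hT'; have [_ _ C0' _] := hT'.
  have [|||x|s [c cE]] := @permutation_lemma _ _ _ C'^T C^T.
  - by move=> r; apply: row_neq0.
  - by move=> r; apply: row_neq0.
  - exact: rows_indep.
  - exact: (supp_le_of_Hfun hT hT' h2).
  apply: (unique_terms F_char0 (s := s) (c := c) hT hT') => // r.
  have [cr rE] := cE r; split=> //; apply: trmx_inj.
  by rewrite linearZ /= !tr_col.
exact/same_terms_matrices/(same_terms_trans (terms _ _ _ hT1) (terms _ _ _ hT2)).
Qed.
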